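(* Let $m,n$ be positive integers, $\mathbf A\in\mathbb R^{m\times n}$, $\mathbf B\in\mathbb R_+^{m\times n}$, $\mathbf c,\mathbf d\in\mathbb R^n_+$, and let $\mathcal X\subseteq\mathbb R^n$ be a polyhedral set. Let $S_1,\dots,S_L$ be a partition of $\{1,\dots,m\}$ (pairwise disjoint with union $[m]$), let $w_{\ell i}\in[0,1]$ for $\ell\in[L]$, $i\in S_\ell$, and let $$\mathcal U=\Big\{\mathbf h\in[0,1]^m \;\Big|\; \sum_{i\in S_\ell} w_{\ell i}h_i\le 1\ \ \forall \ell\in[L]\Big\}.$$ Then $$z_{\sf Aff}(\mathcal U)=O\!\left(\frac{\log^2 n}{\log\log n}\right)\cdot z_{\sf AR}(\mathcal U),$$ where the implied constant is absolute (in particular independent of $L$).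
   Context: For an uncertainty set $\mathcal U\subseteq\mathbb R^m_+$, the two-stage adjustable robust problem is $$z_{\sf AR}(\mathcal U)=\min_{\mathbf x\in\mathcal X}\ \mathbf c^T\mathbf x+\max_{\mathbf h\in\mathcal U}\ \min_{\mathbf y(\mathbf h)\in\mathbb R^n_+}\mathbf d^T\mathbf y(\mathbf h)\quad\text{s.t. } \mathbf A\mathbf x+\mathbf B\mathbf y(\mathbf h)\ge\mathbf h\ \ \forall \mathbf h\in\mathcal U,$$ where $\mathbf y(\mathbf h)$ may depend arbitrarily on $\mathbf h$. The affine policy problem is $$z_{\sf Aff}(\mathcal U)=\min_{\mathbf x,\mathbf P,\mathbf q}\ \mathbf c^T\mathbf x+\max_{\mathbf h\in\mathcal U}\mathbf d^T(\mathbf P\mathbf h+\mathbf q)\ \text{ s.t. } \mathbf A\mathbf x+\mathbf B(\mathbf P\mathbf h+\mathbf q)\ge\mathbf h,\ \mathbf P\mathbf h+\mathbf q\ge\mathbf 0\ \ \forall\mathbf h\in\mathcal U,\ \ \mathbf x\in\mathcal X,\ \mathbf P\in\mathbb R^{n\times m},\ \mathbf q\in\mathbb R^n.$$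
   Formalization: The polyhedral set X is additionally assumed to lie in the nonnegative orthant; without this the first-stage cost can be negative and the bound fails (e.g. A=0, d=0, B all ones, c=e_1, X={-e_1} gives both values -1). *)

(* Defs.v *)
From HB Require Import structures.
From mathcomp Require Import all_boot all_order all_algebra.
From mathcomp Require Import all_classical all_reals all_analysis.
Set Implicit Arguments. Unset Strict Implicit. Unset Printing Implicit Defensive.
Import Order.TTheory GRing.Theory Num.Theory.
Local Open Scope classical_set_scope.
Local Open Scope ring_scope.

Section Defs.
Variable R : realType.

Definition lev (k : nat) (u v : 'cV[R]_k) : Prop := forall i, u i 0 <= v i 0.

Definition nonneg (k : nat) (u : 'cV[R]_k) : Prop := forall i, 0 <= u i 0.

Definition dotv (k : nat) (u v : 'cV[R]_k) : R := (u^T *m v) 0 0.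

Definition polyhedral (k : nat) (X : set 'cV[R]_k) : Prop :=
  exists (p : nat) (G : 'M[R]_(p, k)) (g : 'cV[R]_p),
    X = [set x | lev (G *m x) g].

Definition Uset (m L : nat) (S : 'I_L -> {set 'I_m}) (w : 'I_L -> 'I_m -> R)
  : set 'cV[R]_m :=
  [set h | (forall i, 0 <= h i 0 <= 1) /\
           (forall l : 'I_L, \sum_(i in S l) w l i * h i 0 <= 1)].

Local Open Scope ereal_scope.

(* z_AR(U): fully adjustable two-stage robust value (inf over empty set = +oo) *)
Definition z_AR (m n : nat) (A B : 'M[R]_(m, n)) (c d : 'cV[R]_n)
  (X : set 'cV[R]_n) (U : set 'cV[R]_m) : \bar R :=
  ereal_inf [set ((dotv c x)%:E +
     ereal_sup [set ereal_inf [set (dotv d y)%:E | y in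
                   [set y : 'cV[R]_n | nonneg y /\ lev h (A *m x + B *m y)]]
               | h in U]) | x in X].

Definition z_Aff (m n : nat) (A B : 'M[R]_(m, n)) (c d : 'cV[R]_n)
  (X : set 'cV[R]_n) (U : set 'cV[R]_m) : \bar R :=
  ereal_inf [set ((dotv c xPq.1.1)%:E +
     ereal_sup [set (dotv d (xPq.1.2 *m h + xPq.2))%:E | h in U])
   | xPq in [set xPq : 'cV[R]_n * 'M[R]_(n, m) * 'cV[R]_n |
        X xPq.1.1 /\
        forall h, U h ->
          lev h (A *m xPq.1.1 + B *m (xPq.1.2 *m h + xPq.2)) /\
          nonneg (xPq.1.2 *m h + xPq.2)]].

End Defs.

(* Main.v *)
Require Import Defs.
From HB Require Import structures.
From mathcomp Require Import all_boot all_order all_algebra.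
From mathcomp Require Import all_classical all_reals all_analysis.
From mathcomp Require Import ring lra.
Import Order.TTheory GRing.Theory Num.Theory.
Local Open Scope classical_set_scope.
Local Open Scope ring_scope.

(** For a fixed first stage [x], put [t_i = max(0, 1 - (A x)_i)] and
    [E_ij = B_ij / (t_i d_j)]: row [i] asks for [sum_j E_ij Q_j >= 1], where [Q_j]
    is the money spent on column [j], and the cheapest single column for [i]
    costs [1 / e_i] with [e_i = max_j E_ij].  The affine policy covers some rows by
    a static solution [Q] and each other row [i] linearly, by spending [h_i / e_i]
    on its cheapest column.  If [1 / e_i <= w_i theta_l] for all linear rows of each
    [S_l], the linear part costs at most [sum_l theta_l].

    Both [Q] and [theta] come from a multiplicative-weights greedy algorithm.
    Start from [Q_j = z / n], with [z] the adjustable value, and scan the rows by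
    increasing [w_i e_i].  A row covered neither by [Q] nor by the budget price of
    its group is added to a set [H]; then [Q_j] is multiplied by [1 + E_ij / e_i]
    and [1 / e_i] is added to the cheapest column, so that the total grows by at
    most [2 / e_i].  The set [H] is a union of two 0/1 scenarios of the uncertainty
    set, hence is covered at cost [2 z], which gives
    [T := sum_H 1 / e_i <= 2 z M] where [M] is the largest load
    [sum_(i in H) E_ij / e_i].  On the other hand
    [(z / n) exp (M / 2) <= max Q_j <= z + 2 T], so [M = O(log n)], and the total
    cost [O(z + T)] is [O(log n) z], better than the claimed factor. *)

(** * Multiplicative-weights greedy algorithm *)

(** Follows from exp(-x/2) >= 1 - x/2 and (1 + x)(1 - x/2) >= 1. It turns each update factor 1 +
    E_ij / e_i into an exponential of the load. *)
Lemma expR_half_le {R : realType} (x : R) : 0 <= x <= 1 -> expR (x / 2) <= 1 + x.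
Proof.
move=> /andP[x0 x1].
have := expR_ge1Dx (- (x / 2)); have := expR_gt0 (x / 2).
rewrite expRN; set y := expR _ => y0.
rewrite -(ler_pM2l y0) divff ?gt_eqF// => h; nra.
Qed.

(** Adding two sums, rather than summing over a union, avoids tracking disjointness of the sets. *)
Definition sum2 {R : realType} {I : finType} (H1 H2 : {set I}) (f : I -> R) :=
  \sum_(k in H1) f k + \sum_(k in H2) f k.

(** [H1] and [H2] are each within every budget; a group whose [H2]-part has
    positive weight has total weight at least 1 and is closed. *)
Definition greedy_state {R : realType} {I J L : finType} (E : I -> J -> R)
    (b : I -> J) (v : I -> R) (cl : I -> L) (delta : R) (s : seq I)
    (Q : J -> R) (H1 H2 : {set I}) : Prop :=
  [/\ {subset H1 <= s}, {subset H2 <= s} &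
    forall l, [/\ \sum_(k in H1) v k *+ (cl k == l) <= 1,
      \sum_(k in H2) v k *+ (cl k == l) <= 1 &
      sum2 H1 H2 (fun k => v k *+ (cl k == l)) < 1 ->
      \sum_(k in H2) v k *+ (cl k == l) = 0]] /\
  [/\ forall j, delta * expR (sum2 H1 H2 (fun k => E k j / E k (b k)) / 2) <= Q j,
    \sum_j Q j <= delta * #|J|%:R + 2 * sum2 H1 H2 (fun k => (E k (b k))^-1) &
    forall i, i \in s -> 1 <= \sum_j E i j * Q j \/
      1 <= v i * E i (b i) * sum2 H1 H2 (fun k => (E k (b k))^-1 *+ (cl k == cl i))].

(** The induction treats the tail of [s] first, so this decreasing order amounts to a scan by
    increasing [v i * E i (b i)]. *)
Lemma greedy {R : realType} {I J L : finType} (E : I -> J -> R) (b : I -> J)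
    (v : I -> R) (cl : I -> L) (delta : R) (s : seq I) :
  0 <= delta -> (forall i j, 0 <= E i j <= E i (b i)) ->
  (forall i, 0 <= v i <= 1) ->
  uniq s -> sorted (fun x y => v y * E y (b y) <= v x * E x (b x)) s ->
  {in s, forall i, 0 < E i (b i)} ->
  exists Q H1 H2, greedy_state E b v cl delta s Q H1 H2.
Proof.
move=> delta0 EP vP; elim: s => [_ _ _|i s IH].
  exists (fun=> delta), finset.set0, finset.set0.
  have sum0 f : @sum2 R I finset.set0 finset.set0 f = 0.
    by rewrite /sum2 !big_set0 addr0.
  split; split=> //=.
  - by move=> k; rewrite inE.
  - by move=> k; rewrite inE.
  - by move=> l; rewrite !big_set0 ler01.
  - by move=> j; rewrite sum0 mul0r expR0 mulr1.
  - by rewrite sum0 mulr0 addr0 sumr_const mulr_natr.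
rewrite cons_uniq => /andP[is' us] srt spos.
have rle : {in s, forall k, v k * E k (b k) <= v i * E i (b i)}.
  apply/allP; apply: order_path_min srt => x y w /= h1 h2.
  exact: le_trans h2 h1.
have {}spos' : {in s, forall k, 0 < E k (b k)}.
  by move=> k ks; apply: spos; rewrite inE ks orbT.
have ei0 : 0 < E i (b i) by apply: spos; rewrite mem_head.
have [Q [H1 [H2]]] := IH us (path_sorted srt) spos'.
move=> -[[sub1 sub2 feas] [Qlb Qub cov]].
have Q0 j : 0 <= Q j.
  by apply: le_trans (Qlb j); rewrite mulr_ge0// expR_ge0.
have subc (H : {set I}) : {subset H <= s} -> {subset H <= i :: s}.
  by move=> sub k kH; rewrite inE sub ?orbT.
have iN1 : i \notin H1 by apply: contra is' => /sub1.
have iN2 : i \notin H2 by apply: contra is' => /sub2.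
have keep : 1 <= \sum_j E i j * Q j \/
    1 <= v i * E i (b i) * sum2 H1 H2 (fun k => (E k (b k))^-1 *+ (cl k == cl i)) ->
  forall k, k \in i :: s -> 1 <= \sum_j E k j * Q j \/
    1 <= v k * E k (b k) * sum2 H1 H2 (fun k' => (E k' (b k'))^-1 *+ (cl k' == cl k)).
  by move=> ci k; rewrite inE => /orP[/eqP->//|]; exact: cov.
have [ci|unc] := leP 1 (\sum_j E i j * Q j).
  exists Q, H1, H2; split; split=> //; [exact: subc|exact: subc|].
  by apply: keep; left.
(* Rows scanned earlier have smaller w_k e_k, so the price sum_k 1 / e_k of a
   full group covers i as well. *)
have [full|room] := leP 1 (sum2 H1 H2 (fun k => v k *+ (cl k == cl i))).
  exists Q, H1, H2; split; split=> //; [exact: subc|exact: subc|].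
  apply: keep; right; apply: le_trans full _.
  rewrite /sum2 mulrDr !mulr_sumr.
  have le k : k \in s -> v k *+ (cl k == cl i) <=
      v i * E i (b i) * ((E k (b k))^-1 *+ (cl k == cl i)).
    move=> ks; case: (cl k == cl i); rewrite ?mulr0n ?mulr0// !mulr1n.
    by rewrite ler_pdivlMr ?spos'// rle.
  by apply: lerD; apply: ler_sum => k kH; apply: le; [exact: sub1|exact: sub2].
have [w1 w2 w20] := feas (cl i).
have {}w20 := w20 room.
pose Q' j := Q j * (1 + E i j / E i (b i)) + (E i (b i))^-1 *+ (j == b i).
have ratio j : 0 <= E i j / E i (b i) <= 1.
  have /andP[h1 h2] := EP i j.
  by rewrite divr_ge0 ?(ltW ei0)//= ler_pdivrMr// mul1r.
have QQ' j : Q j <= Q' j.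
  have /andP[h1 h2] := ratio j.
  rewrite /Q' mulrDr mulr1 -addrA lerDl; apply: addr_ge0; first exact: mulr_ge0.
  by rewrite mulrn_wge0 ?invr_ge0 ?(ltW ei0).
have covmono k : 1 <= \sum_j E k j * Q j -> 1 <= \sum_j E k j * Q' j.
  move=> h; apply: le_trans h _; apply: ler_sum => j _.
  by rewrite ler_wpM2l//; case/andP: (EP k j).
have covi : 1 <= \sum_j E i j * Q' j.
  rewrite (bigD1 (b i))//= -[leLHS]addr0 lerD//.
    rewrite /Q' eqxx mulrDr mulr1n divff ?gt_eqF// lerDr mulr_ge0 ?(ltW ei0)//.
    rewrite mulr_ge0// addr_ge0//; by case/andP: (ratio (b i)).
  apply: sumr_ge0 => j _; apply: mulr_ge0; last exact: le_trans (QQ' j).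
  by case/andP: (EP i j).
(* Costs, loads and coverage see the two sets only through [sum2], so both ways of inserting [i]
   share this verification. *)
have add H1' H2' :
    (forall f : I -> R, sum2 H1' H2' f = f i + sum2 H1 H2 f) ->
    {subset H1' <= i :: s} -> {subset H2' <= i :: s} ->
    (forall l, [/\ \sum_(k in H1') v k *+ (cl k == l) <= 1,
      \sum_(k in H2') v k *+ (cl k == l) <= 1 &
      sum2 H1' H2' (fun k => v k *+ (cl k == l)) < 1 ->
      \sum_(k in H2') v k *+ (cl k == l) = 0]) ->
  exists Q H1 H2, greedy_state E b v cl delta (i :: s) Q H1 H2.
  move=> sumE s1 s2 fe; exists Q', H1', H2'.
  split; split=> //.
  - move=> j; rewrite sumE mulrDl expRD mulrCA mulrC.
    apply: (@le_trans _ _ (Q j * (1 + E i j / E i (b i)))).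
      by apply: ler_pM; rewrite ?mulr_ge0 ?expR_ge0 ?expR_half_le.
    by rewrite /Q' lerDl mulrn_wge0 ?invr_ge0 ?(ltW ei0).
  (* By [unc] the multiplicative update adds less than 1 / e_i; the additive term adds another 1 /
     e_i. *)
  - rewrite sumE big_split/=.
    have -> : \sum_j (E i (b i))^-1 *+ (j == b i) = (E i (b i))^-1.
      by rewrite (bigD1 (b i))//= eqxx big1 ?addr0// => j /negPf ->.
    have -> : \sum_j Q j * (1 + E i j / E i (b i)) =
        \sum_j Q j + (\sum_j E i j * Q j) * (E i (b i))^-1.
      rewrite mulr_suml -big_split/=; apply: eq_bigr => j _; ring.
    have : 0 < (E i (b i))^-1 by rewrite invr_gt0.
    move: unc Qub; clear; nra.
  - move=> k; rewrite inE => /orP[/eqP->|ks]; first by left.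
    have [/covmono|h] := cov k ks; [by left|right].
    apply: le_trans h _; apply: ler_wpM2l.
      by rewrite mulr_ge0//; [case/andP: (vP k)|case/andP: (EP k (b k))].
    by rewrite sumE lerDr mulrn_wge0 ?invr_ge0 ?(ltW ei0).
have subU (H : {set I}) : {subset H <= s} -> {subset (i |: H)%SET <= i :: s}.
  by move=> sub k; rewrite !inE => /orP[->//|/sub ->]; rewrite orbT.
have [vi0 vi1] := andP (vP i).
have [fits|over] := leP (v i + \sum_(k in H1) v k *+ (cl k == cl i)) 1.
  apply: (add (i |: H1)%SET H2); [|exact: subU|exact: subc|].
    by move=> f; rewrite /sum2 big_setU1//= addrA.
  move=> l; have [f1 f2 f3] := feas l; rewrite /sum2 big_setU1//=.
  have [ll|ll] := eqVneq (cl i) l.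
    by rewrite -ll mulr1n; split.
  by rewrite mulr0n add0r.
(* The [H1]-part plus [v i] exceeds 1, so the group closes; its [H2]-part was zero and becomes
   [v i]. *)
apply: (add H1 (i |: H2)%SET); [|exact: subc|exact: subU|].
  by move=> f; rewrite /sum2 big_setU1//= addrCA.
move=> l; have [f1 f2 f3] := feas l; rewrite /sum2 big_setU1//=.
have [ll|ll] := eqVneq (cl i) l.
  rewrite -ll mulr1n w20 addr0; split=> //.
  by rewrite addrC ltNge (ltW over).
by rewrite mulr0n add0r.
Qed.

(** * Logarithmic bound on the load *)

Lemma ge1_ln_nat {R : realType} (n : nat) : (4 <= n)%N -> 1 <= ln (n%:R : R).
Proof.
move=> n4; have n0 : (0 : R) < n%:R by rewrite ltr0n (leq_trans _ n4).
rewrite -ler_expR lnK//.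
have half : expR (1 / 2) <= 2 :> R.
  by have := @expR_half_le R 1; rewrite ler01 lexx => /(_ isT); rewrite -natr1.
have -> : 1 = 1 / 2 + 1 / 2 :> R by field.
rewrite expRD; apply: (@le_trans _ _ (2 * 2)).
  by apply: ler_pM; rewrite ?expR_ge0.
have : (4%:R : R) <= n%:R by rewrite ler_nat.
lra.
Qed.

(** Write exp(x/2) as the square of exp(x/4) and bound one factor below by 1 + x/4. Since 1 + 4x <=
    16 (1 + x/4), this factor cancels and leaves exp(x/4) <= 16 n <= n^4. *)
Lemma load_le_ln {R : realType} (n : nat) (x : R) :
  (4 <= n)%N -> 0 <= x -> expR (x / 2) <= n%:R * (1 + 4 * x) -> x <= 16 * ln n%:R.
Proof.
move=> n4 x0 h; have n0 : (0 : R) < n%:R by rewrite ltr0n (leq_trans _ n4).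
have n4' : (4 : R) <= n%:R by rewrite ler_nat.
have e2 : expR (x / 2) = expR (x / 4) * expR (x / 4).
  by rewrite -expRD; congr expR; field.
have e1 : 1 + x / 4 <= expR (x / 4) by exact: expR_ge1Dx.
have e3 : expR (x / 4) <= n%:R * 16.
  have p : 0 < 1 + x / 4 by rewrite ltr_pwDl ?divr_ge0.
  rewrite -(ler_pM2r p); apply: (@le_trans _ _ (expR (x / 2))).
    by rewrite e2 ler_wpM2l ?expR_ge0.
  apply: le_trans h _; rewrite -mulrA ler_pM2l//; lra.
have e4 : n%:R * 16 <= expR (4 * ln n%:R) :> R.
  have -> : 4 * ln n%:R = ln n%:R + ln n%:R + (ln n%:R + ln n%:R) :> R by ring.
  rewrite !expRD !lnK//; set N := n%:R in n0 n4' *.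
  have N16 : 16 <= N * N by nra.
  by rewrite -mulrA ler_pM2l//; nra.
have := le_trans e3 e4; rewrite ler_expR; lra.
Qed.

(** * Covering by a static solution and group prices *)

Lemma sum2_sum {R : realType} {I J : finType} (H1 H2 : {set I}) (F : J -> I -> R) :
  sum2 H1 H2 (fun k => \sum_j F j k) = \sum_j sum2 H1 H2 (F j).
Proof. by rewrite /sum2 big_split/= exchange_big/= [X in _ + X]exchange_big. Qed.

Lemma covering {R : realType} {I J L : finType} (E : I -> J -> R) (v : I -> R)
    (cl : I -> L) (D : {set I}) (z : R) :
  0 < z -> (4 <= #|J|)%N -> (forall i j, 0 <= E i j) ->
  (forall i, 0 <= v i <= 1) ->
  (forall H : {set I}, {subset H <= D} ->
    (forall l, \sum_(k in H) v k *+ (cl k == l) <= 1) ->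
    exists y : J -> R, [/\ forall j, 0 <= y j, \sum_j y j <= z &
      forall i, i \in H -> 1 <= \sum_j E i j * y j]) ->
  exists (Q : J -> R) (theta : L -> R) (b : I -> J),
    [/\ forall j, 0 <= Q j, forall l, 0 <= theta l,
      forall i, i \in D -> 1 <= \sum_j E i j * Q j \/
        0 < E i (b i) /\ 1 <= v i * E i (b i) * theta (cl i) &
      \sum_j Q j + \sum_l theta l <= 97 * ln #|J|%:R * z].
Proof.
move=> z0 J4 E0 vP cov.
have J0 : (0 < #|J|)%N by apply: leq_trans J4.
have n0 : (0 : R) < #|J|%:R by rewrite ltr0n.
have /card_gt0P[j0 _] := J0.
pose b i := [arg max_(j > j0) E i j]%O.
have EP i j : 0 <= E i j <= E i (b i).
  by rewrite E0/= /b; case: arg_maxP => // k _; exact.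
(* The singleton scenario is feasible because [v i] is at most 1, so some column must serve row
   [i]. *)
have epos i : i \in D -> 0 < E i (b i).
  move=> iD; have [||y [y0 _ yc]] := cov (finset.set1 i).
  - by move=> k; rewrite inE => /eqP->.
  - move=> l; rewrite big_set1; have /andP[v0 v1] := vP i.
    by case: (cl i == l); rewrite ?mulr1n ?mulr0n ?ler01.
  rewrite ltNge; apply/negP => e0.
  have := yc i; rewrite inE eqxx big1 => [/(_ isT)|j _]; first by rewrite ler10.
  have /andP[h1 h2] := EP i j.
  suff -> : E i j = 0 by rewrite mul0r.
  by apply/eqP; rewrite eq_le h1 andbT (le_trans h2).
pose ord := fun x y : I => v y * E y (b y) <= v x * E x (b x).
pose s := sort ord (enum D).
have memS i : (i \in s) = (i \in D) by rewrite mem_sort mem_enum.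
have us : uniq s by rewrite sort_uniq enum_uniq.
have ss : sorted ord s by apply: sort_sorted => x y; exact: le_total.
have delta0 : 0 <= z / #|J|%:R by rewrite divr_ge0 ?ltW.
have spos : {in s, forall i, 0 < E i (b i)} by move=> i; rewrite memS; exact: epos.
have [Q [H1 [H2 [[sub1 sub2 feas] [Qlb Qub Qcov]]]]] :=
  greedy E b v cl (z / #|J|%:R) s delta0 EP vP us ss spos.
have {}sub1 : {subset H1 <= D} by move=> i /sub1; rewrite memS.
have {}sub2 : {subset H2 <= D} by move=> i /sub2; rewrite memS.
have Q0 j : 0 <= Q j.
  by apply: le_trans (Qlb j); rewrite mulr_ge0 ?expR_ge0.
have Einv i : 0 <= (E i (b i))^-1.
  by rewrite invr_ge0; case/andP: (EP i (b i)) => h; exact: le_trans.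
have sum2_ge0 f : (forall i, 0 <= f i) -> 0 <= sum2 H1 H2 f.
  by move=> f0; rewrite /sum2 addr_ge0// sumr_ge0.
pose T := sum2 H1 H2 (fun k => (E k (b k))^-1).
pose load j := sum2 H1 H2 (fun k => E k j / E k (b k)).
have load0 j : 0 <= load j by apply: sum2_ge0 => i; rewrite mulr_ge0.
pose jm := [arg max_(j > j0) load j]%O.
pose M := load jm.
have loadM j : load j <= M by rewrite /M /jm; case: arg_maxP => // k _; exact.
have M0 : 0 <= M by exact: load0.
(* Weight the covering inequality of each row k by 1 / e_k and exchange the sums: the loads appear
   as coefficients of [y]. *)
have TM : T <= 2 * z * M.
  have bnd (H : {set I}) : {subset H <= D} ->
      (forall l, \sum_(k in H) v k *+ (cl k == l) <= 1) -> exists y : J -> R,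
      [/\ forall j, 0 <= y j, \sum_j y j <= z &
      \sum_(k in H) (E k (b k))^-1 <=
      \sum_j (\sum_(k in H) E k j / E k (b k)) * y j].
    move=> HD Hf; have [y [y0 yz yc]] := cov H HD Hf; exists y; split=> //.
    under [leRHS]eq_bigr do rewrite mulr_suml.
    rewrite exchange_big/=; apply: ler_sum => k kH.
    rewrite -[leLHS]mulr1; apply: le_trans (ler_wpM2l (Einv k) (yc k kH)) _.
    rewrite mulr_sumr; apply: ler_sum => j _.
    by rewrite mulrA [X in X * _]mulrC.
  have [y1 [y10 y1z b1]] := bnd H1 sub1 (fun l => let: And3 h _ _ := feas l in h).
  have [y2 [y20 y2z b2]] := bnd H2 sub2 (fun l => let: And3 _ h _ := feas l in h).
  have le (H : {set I}) (y : J -> R) : (forall j, 0 <= y j) -> \sum_j y j <= z ->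
      (forall j, \sum_(k in H) E k j / E k (b k) <= M) ->
      \sum_j (\sum_(k in H) E k j / E k (b k)) * y j <= z * M.
    move=> y0 yz lM; apply: (@le_trans _ _ (\sum_j M * y j)).
      by apply: ler_sum => j _; rewrite ler_wpM2r.
    by rewrite -mulr_sumr mulrC ler_wpM2r.
  have p k j : 0 <= E k j / E k (b k) by rewrite mulr_ge0.
  have -> : 2 * z * M = z * M + z * M by ring.
  rewrite /T /sum2; apply: lerD.
    apply: le_trans b1 (le _ _ y10 y1z _) => j.
    by apply: le_trans (loadM j); rewrite lerDl sumr_ge0.
  apply: le_trans b2 (le _ _ y20 y2z _) => j.
  by apply: le_trans (loadM j); rewrite lerDr sumr_ge0.
have QT : \sum_j Q j <= z + 2 * T.
  by move: Qub; rewrite -mulrA mulVf ?gt_eqF// mulr1.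
have Mln : M <= 16 * ln #|J|%:R.
  (* At the column of maximal load, (z / n) exp(M / 2) is at most z + 2T, hence at most z (1 +
     4M). *)
  apply: load_le_ln => //; rewrite -(ler_pM2l (divr_gt0 z0 n0)).
  apply: (@le_trans _ _ (z + 2 * T)).
    apply: le_trans (Qlb jm) (le_trans _ QT).
    by rewrite (bigD1 jm)//= lerDl sumr_ge0.
  rewrite mulrA -[_ / _ * _]mulrA mulVf ?gt_eqF// mulr1; nra.
have lnge := @ge1_ln_nat R _ J4.
pose theta l := sum2 H1 H2 (fun k => (E k (b k))^-1 *+ (cl k == l)).
have thetaT : \sum_l theta l = T.
  rewrite -sum2_sum /T; congr sum2; apply/funext => k.
  by rewrite (bigD1 (cl k))//= eqxx big1 ?addr0// => l; rewrite eq_sym => /negPf->.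
exists Q, theta, b; split=> //.
- by move=> l; apply: sum2_ge0 => i; rewrite mulrn_wge0.
- move=> i iD; have := Qcov i; rewrite memS => /(_ iD)[|h]; first by left.
  by right; rewrite epos.
(* The total is at most z + 3T, with T <= 32 z ln n and ln n >= 1; hence 97. *)
rewrite thetaT; nra.
Qed.

(** * Affine policy for a fixed first stage *)

Lemma dotvE {R : realType} (k : nat) (u v : 'cV[R]_k) :
  dotv u v = \sum_j u j 0 * v j 0.
Proof. by rewrite /dotv mxE; apply: eq_bigr => j _; rewrite mxE. Qed.

(** Here [a] stands for A x. The policy adds a linear part, the static purchase Q_j / d'_j, and a
    solution [u0] of the zero scenario that compensates negative entries of [a]. *)
Lemma affine_policy {R : realType} {m n L : nat} (B : 'M[R]_(m, n))
    (d : 'cV[R]_n) (a : 'cV[R]_m) (S : 'I_L -> {set 'I_m})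
    (w : 'I_L -> 'I_m -> R) (z : R) :
  (4 <= n)%N -> 0 < z -> (forall i j, 0 <= B i j) -> nonneg d ->
  (forall l1 l2, l1 != l2 -> S l1 :&: S l2 = finset.set0) ->
  (forall i : 'I_m, exists l, i \in S l) ->
  (forall l i, i \in S l -> 0 <= w l i <= 1) ->
  (forall h, Uset S w h ->
    exists y, [/\ nonneg y, lev h (a + B *m y) & dotv d y <= z]) ->
  exists (P : 'M[R]_(n, m)) (q : 'cV[R]_n), forall h, Uset S w h ->
    [/\ lev h (a + B *m (P *m h + q)), nonneg (P *m h + q) &
      dotv d (P *m h + q) <= 195 * ln n%:R * z].
Proof.
move=> n4 z0 B0 d0 disj cover wP adj.
have [cl clS] := choice cover.
have clE i l : (cl i == l) = (i \in S l).
  apply/eqP/idP => [<-//|il]; apply/eqP; apply/negPn/negP => /disj/setP/(_ i).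
  by rewrite !inE clS il.
pose v i := w (cl i) i.
have vP i : 0 <= v i <= 1 by exact: wP.
have budgetE l (h : 'I_m -> R) :
    \sum_(i in S l) w l i * h i = \sum_i v i * h i *+ (cl i == l).
  rewrite big_mkcond; apply: eq_bigr => i _; rewrite -clE /v.
  by have [->|] := eqVneq (cl i) l.
pose ind (H : {set 'I_m}) : 'cV[R]_m := \col_i (i \in H)%:R.
pose feas (H : {set 'I_m}) := forall l, \sum_(k in H) v k *+ (cl k == l) <= 1.
have indU H : feas H -> Uset S w (ind H).
  move=> fH; split=> [i|l].
    by rewrite mxE; case: (i \in H); rewrite ?ler01 ?lexx.
  apply: le_trans (fH l); rewrite (budgetE l (fun i => ind H i 0)).
  rewrite [leRHS]big_mkcond; apply: ler_sum => i _; rewrite mxE.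
  by case: (i \in H); rewrite ?mulr1// mulr0 mul0rn.
(* Infeasible sets get the default 0, so [eta] can use one finite sum over all sets. *)
have /choice[y yP] : forall H, exists y : 'cV[R]_n, nonneg y /\
    (feas H -> lev (ind H) (a + B *m y) /\ dotv d y <= z).
  move=> H; have [fH|nfH] := pselect (feas H).
    by have [u [u0 uc uz]] := adj _ (indU H fH); exists u.
  by exists 0; split=> // j; rewrite mxE.
have y0 H j : 0 <= y H j 0 by exact: (yP H).1.
(* The perturbed prices d + eta are positive and at most double the cost of
   the finitely many scenario solutions. *)
pose eta := z / (1 + \sum_H \sum_j y H j 0).
have tot0 : 0 < 1 + \sum_H \sum_j y H j 0.
  by rewrite ltr_pwDl// sumr_ge0// => H _; rewrite sumr_ge0.
have eta0 : 0 < eta by rewrite divr_gt0.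
have etaz H : eta * \sum_j y H j 0 <= z.
  rewrite /eta -mulrA -[leRHS]mulr1 ler_pM2l// mulrC ler_pdivrMr// mul1r.
  rewrite (bigD1 H)//= addrCA lerDl addr_ge0// sumr_ge0// => H' _.
  by rewrite sumr_ge0.
pose d' j := d j 0 + eta.
have d'0 j : 0 < d' j by rewrite ltr_wpDl.
pose t i := Num.max 0 (1 - a i 0).
have t0 i : 0 <= t i by rewrite /t le_max lexx.
pose D := [set i | 0 < t i]%SET.
have tD i : i \in D -> t i = 1 - a i 0.
  by rewrite inE /t; case: (leP 0 (1 - a i 0)) => // _; rewrite ltxx.
pose E i j := B i j / (t i * d' j).
have E0 i j : 0 <= E i j by rewrite divr_ge0// mulr_ge0// ltW.
have BE i j : i \in D -> B i j = t i * E i j * d' j.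
  rewrite inE => ti; rewrite /E; field.
  by rewrite !gt_eqF.
have [|||||Q [th [b [Q0 th0 Qcov Qcost]]]] := @covering R 'I_m 'I_n 'I_L E v cl D (2 * z).
- by rewrite mulr_gt0.
- by rewrite card_ord.
- exact: E0.
- exact: vP.
- move=> H HD fH; exists (fun j => d' j * y H j 0); split.
  + by move=> j; rewrite mulr_ge0// ltW.
  + have [_ /(_ fH)[_]] := yP H; rewrite dotvE => dy.
    under eq_bigr do rewrite mulrDl.
    by rewrite big_split/= -mulr_sumr mulr_natl mulr2n lerD.
  + move=> i iH; have iD := HD i iH.
    have [_ /(_ fH)[/(_ i)]] := yP H; rewrite !mxE iH => h _.
    have ti : 0 < t i by move: iD; rewrite inE.
    rewrite -(ler_pM2l ti) mulr1 mulr_sumr tD// lerBlDl.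
    apply: le_trans h _; rewrite lerD2l; apply: ler_sum => j _.
    by rewrite BE// tD// !mulrA.
have [u0 [u00 u0c u0z]] : exists y, [/\ nonneg y, lev 0 (a + B *m y) & dotv d y <= z].
  apply: adj; split=> [i|l]; first by rewrite mxE lexx ler01.
  by rewrite big1 ?ler01// => i _; rewrite mxE mulr0.
(* [N] marks the rows left to the linear part; dividing by [d'] converts money into column units. *)
pose N i := (i \in D) && (\sum_j E i j * Q j < 1).
have NP i : N i -> 0 < E i (b i) /\ 1 <= v i * E i (b i) * th (cl i).
  by case/andP => iD; have [|//] := Qcov i iD; rewrite leNgt => /negP.
pose P : 'M[R]_(n, m) := \matrix_(j, i) ((E i (b i) * d' j)^-1 *+ (N i && (j == b i))).
pose q : 'cV[R]_n := \col_j (Q j / d' j) + u0.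
exists P, q => h hU; have [h01 hw] := hU.
have h0 i : 0 <= h i 0 by case/andP: (h01 i).
have P0 j i : 0 <= P j i.
  by rewrite mxE mulrn_wge0// invr_ge0 mulr_ge0// ltW.
have YE j : (P *m h + q) j 0 = \sum_i P j i * h i 0 + (Q j / d' j + u0 j 0).
  by rewrite !mxE.
have Qd j : 0 <= Q j / d' j by rewrite divr_ge0// ltW.
have Y0 : nonneg (P *m h + q).
  move=> j; rewrite YE addr_ge0 ?addr_ge0//.
  by rewrite sumr_ge0// => i _; rewrite mulr_ge0.
split=> //.
- move=> i; have /andP[_ hi1] := h01 i.
  rewrite mxE [X in _ + X]mxE.
  have [iD|iD] := boolP (i \in D); last first.
    have ai : 1 <= a i 0.
      move: iD; rewrite inE /t; case: (leP 0 (1 - a i 0)) => [|? _]; last by lra.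
      by rewrite -leNgt; lra.
    apply: le_trans hi1 (le_trans ai _); rewrite lerDl sumr_ge0// => j _.
    by rewrite mulr_ge0.
  have u0i := u0c i; move: u0i; rewrite !mxE => u0i.
  set Bu := \sum_j B i j * u0 j 0 in u0i.
  have Bu0 : 0 <= Bu by rewrite sumr_ge0// => j _; rewrite mulr_ge0.
  have lb : t i * \sum_j E i j * Q j + (t i * h i 0) *+ N i + Bu <=
      \sum_j B i j * (P *m h + q) j 0.
    have -> : (t i * h i 0) *+ N i = \sum_j B i j * (P j i * h i 0).
      rewrite (bigD1 (b i))//= big1 => [|j /negPf jb].
        rewrite addr0 mxE eqxx andbT BE//; have := NP i.
        case: (N i) => [/(_ isT)[Eb _]|_]; last by rewrite !mulr0n mul0r mulr0.
        by rewrite !mulr1n; field; rewrite !gt_eqF.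
      by rewrite mxE jb andbF mulr0n mul0r mulr0.
    rewrite mulr_sumr /Bu -!big_split/=; apply: ler_sum => j _.
    rewrite YE.
    have -> : t i * (E i j * Q j) = B i j * (Q j / d' j).
      by rewrite BE//; field; rewrite gt_eqF.
    rewrite -!mulrDr ler_wpM2l// addrAC addrC lerD2r.
    by rewrite (bigD1 i)//= lerDl sumr_ge0// => k _; rewrite mulr_ge0.
  have ti : t i = 1 - a i 0 by exact: tD.
  have key : t i * h i 0 + Bu <= \sum_j B i j * (P *m h + q) j 0.
    apply: le_trans lb; rewrite lerD2r; case NE : (N i).
      by rewrite mulr1n lerDr mulr_ge0// sumr_ge0// => j _; rewrite mulr_ge0.
    rewrite mulr0n addr0 ler_wpM2l//; apply: le_trans hi1 _.
    by move: NE; rewrite /N iD/= => /negbT; rewrite -leNgt.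
  (* It remains to see a_i (1 - h_i) + Bu >= 0, which holds because Bu >= 0 and a_i + Bu >= 0. *)
  have := h0 i; move: key u0i Bu0 hi1; rewrite ti; clear; nra.
rewrite dotvE.
(* A linear row costs h_i / e_i <= th_l v_i h_i, and the budget of group l sums these to at most
   th_l. *)
have cost : \sum_j d' j * (\sum_i P j i * h i 0) <= \sum_l th l.
  have -> : \sum_j d' j * (\sum_i P j i * h i 0) =
      \sum_i (h i 0 / E i (b i)) *+ N i.
    under eq_bigr do rewrite mulr_sumr.
    rewrite exchange_big/=; apply: eq_bigr => i _.
    rewrite (bigD1 (b i))//= big1 => [|j /negPf jb]; last first.
      by rewrite mxE jb andbF mulr0n mul0r mulr0.
    rewrite addr0 mxE eqxx andbT; have := NP i.
    case: (N i) => [/(_ isT)[Eb _]|_]; last by rewrite !mulr0n mul0r mulr0.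
    by rewrite !mulr1n; field; rewrite !gt_eqF.
  apply: (@le_trans _ _ (\sum_i \sum_l th l * (v i * h i 0 *+ (cl i == l)))).
    apply: ler_sum => i _; rewrite (bigD1 (cl i))//= eqxx mulr1n big1 => [|l].
      have /andP[v0 _] := vP i; rewrite addr0; have := NP i.
      case: (N i) => [/(_ isT)[Eb c1]|_]; last by rewrite mulr0n !mulr_ge0.
      rewrite mulr1n ler_pdivrMr//; have := ler_wpM2l (h0 i) c1.
      by rewrite mulr1 => /le_trans; apply; rewrite le_eqVlt; apply/orP; left; apply/eqP; ring.
    by rewrite eq_sym => /negPf ->; rewrite mulr0n mulr0.
  rewrite exchange_big/=; apply: ler_sum => l _; rewrite -mulr_sumr.
  rewrite -[leRHS]mulr1 ler_wpM2l//.
  by rewrite -(budgetE l (fun i => h i 0)).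
have lnge := @ge1_ln_nat R n n4.
move: Qcost; rewrite card_ord => Qcost.
move: u0z; rewrite dotvE => u0z.
(* [covering] at 2z contributes 194 and [u0] contributes 1. *)
apply: (@le_trans _ _ (\sum_l th l + \sum_j Q j + z)); last by nra.
apply: le_trans (lerD (lerD cost (lexx _)) u0z).
rewrite -!big_split/=; apply: ler_sum => j _; rewrite YE addrA mulrDr lerD2r.
have -> : d' j * \sum_i P j i * h i 0 + Q j =
    d' j * (\sum_i P j i * h i 0 + Q j / d' j).
  by rewrite mulrDr; congr (_ + _); field; rewrite gt_eqF.
rewrite ler_wpM2r ?addr_ge0// ?sumr_ge0// => [i _|]; first by rewrite mulr_ge0.
by rewrite /d' lerDl ltW.
Qed.

(** * Passage to the extended-real optimal values *)

Theorem theorem2 (R : realType) :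
  exists (C : R) (N : nat), 0 < C /\
  forall (m n L : nat) (A B : 'M[R]_(m, n)) (c d : 'cV[R]_n)
         (X : set 'cV[R]_n) (S : 'I_L -> {set 'I_m}) (w : 'I_L -> 'I_m -> R),
    (0 < m)%N -> (0 < n)%N -> (N <= n)%N ->
    (forall i j, 0 <= B i j) -> nonneg c -> nonneg d ->
    polyhedral X -> (forall x, X x -> nonneg x) ->
    (forall l1 l2, l1 != l2 -> S l1 :&: S l2 = finset.set0) ->
    (forall i : 'I_m, exists l, i \in S l) ->
    (forall l i, i \in S l -> 0 <= w l i <= 1) ->
    (z_Aff A B c d X (Uset S w) <=
      (C * (ln n%:R ^+ 2 / ln (ln n%:R)))%:E * z_AR A B c d X (Uset S w))%E.
Proof.
(* From n = 5 on, ln n > 1, so ln (ln n) is positive. *)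
exists 195, 5%N; split=> // m n L A B c d X S w _ _ n5 B0 c0 d0 _ X0 disj cover wP.
have n4 : (4 <= n)%N by exact: ltnW.
have ln1 : 1 < ln (n%:R : R).
  apply: le_lt_trans (@ge1_ln_nat R 4 isT) _.
  by rewrite ltr_ln ?posrE ?ltr_nat// ltr0n (leq_trans _ n5).
have lnln0 : 0 < ln (ln (n%:R : R)) by rewrite ln_gt0.
set K := 195 * _.
(* Since ln (ln n) <= ln n, the quotient dominates ln n. *)
have Kln : 195 * ln n%:R <= K.
  rewrite ler_pM2l// ler_pdivlMr// expr2 ler_pM2l ?(lt_trans _ ln1)//.
  rewrite -ler_expR lnK ?posrE ?(lt_trans _ ln1)//.
  by apply: le_trans (expR_ge1Dx _); rewrite lerDr.
have K1 : 1 <= K by lra.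
have K0 : 0 < K by lra.
have U0 : Uset S w 0.
  split=> [i|l]; first by rewrite mxE lexx ler01.
  by rewrite big1 ?ler01// => i _; rewrite mxE mulr0.
have dot0 (u y : 'cV[R]_n) : nonneg u -> nonneg y -> 0 <= dotv u y.
  by move=> hu hy; rewrite dotvE sumr_ge0// => j _; rewrite mulr_ge0.
rewrite -lee_pdivrMl//; apply: le_ereal_inf_tmp => _ [x Xx <-].
rewrite lee_pdivrMl//.
set f := fun h => ereal_inf _; set s := ereal_sup _.
have s0 : (0 <= s)%E.
  apply: (@le_trans _ _ (f 0)); last by apply: ereal_sup_ubound; exists 0.
  by apply: le_ereal_inf_tmp => _ [y [y0 _] <-]; rewrite lee_fin dot0.
have cx0 := dot0 c x c0 (X0 x Xx).
case sE : s => [r| |]; last by rewrite sE in s0.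
- have r0 : 0 <= r by rewrite sE lee_fin in s0.
  rewrite -EFinD -EFinM; apply/lee_addgt0Pr => e e0.
  (* The inner infimum need not be attained; this slack costs only [e] after scaling by [K], and
     makes [z] positive even if [r] is 0. *)
  pose z := r + e / K.
  have eK0 : 0 < e / K by rewrite divr_gt0.
  have z0 : 0 < z by rewrite ltr_wpDl.
  have adj h : Uset S w h ->
      exists y, [/\ nonneg y, lev h (A *m x + B *m y) & dotv d y <= z].
    move=> hU; have /ereal_inf_lt[_ [y [y0 yc] <-]] : (f h < z%:E)%E.
      apply: (@le_lt_trans _ _ s); first by apply: ereal_sup_ubound; exists h.
      by rewrite sE lte_fin ltrDl.
    by rewrite lte_fin => /ltW yz; exists y.
  have [P [q Pq]] := affine_policy B d (A *m x) S w z n4 z0 B0 d0 disj cover wP adj.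
  apply: (@le_trans _ _ (dotv c x + K * z)%:E); last first.
    rewrite -EFinD lee_fin /z !mulrDr [K * (e / K)]mulrC divfK ?gt_eqF//.
    by rewrite addrA lerD2r lerD2r ler_peMl.
  rewrite EFinD; apply: ge_ereal_inf; exists ((dotv c x)%:E +
     ereal_sup [set (dotv d (P *m h + q))%:E | h in Uset S w])%E.
    by exists (x, P, q) => //=; split=> // h /Pq[].
  apply: leeD2l; apply: ge_ereal_sup => _ [h /Pq[_ _ cost] <-].
  by rewrite lee_fin; apply: le_trans cost _; rewrite ler_pM2r.
- by rewrite addey// gt0_muley ?leey// lte_fin.
Qed.
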